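(* Let $n,m\ge 1$ be integers and let $X \subset \mathrm{Mat}_{n \times m}(\mathbb{C})$ be a nonempty, algebraically closed, column-invariant set. Suppose $E$ is a vector subspace of $\mathbb{C}^n$ that does not belong to $[\![ X ]\!]$. Then $$\operatorname{codim} X \ge m + 1 - \dim E,$$ where $\operatorname{codim} X$ is the codimension of $X$ in $\mathrm{Mat}_{n\times m}(\mathbb{C})$.
   Context: $\mathrm{Mat}_{n\times m}(\mathbb{C})$ is the space of complex $n\times m$ matrices, viewed as the affine space $\mathbb{C}^{nm}$. ''Algebraically closed'' subset means Zariski-closed subset (the common zero set of a family of polynomials in the matrix entries). Dimensions and codimensions are complex algebraic; the codimension of an algebraically closed set (possibly reducible) is the minimum of the codimensions of its irreducible components. For $A \in \mathrm{Mat}_{n\times m}(\mathbb{C})$, $\operatorname{col} A \subset \mathbb{C}^n$ denotes the column space of $A$. A set $X \subset \mathrm{Mat}_{n\times m}(\mathbb{C})$ is called column-invariant if whenever $A \in X$, $B \in \mathrm{Mat}_{n\times m}(\mathbb{C})$ and $\operatorname{col} A = \operatorname{col} B$, then $B \in X$. For such $X$ define $$[\![ X ]\!] := \{ E \text{ vector subspace of } \mathbb{C}^n : E \subset \operatorname{col} A \text{ for some } A \in X\}.$$ *)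

(* Defs.v *)
From mathcomp Require Import all_boot all_order all_algebra.
From mathcomp Require Import complex.
From mathcomp Require Import classical_sets reals constructive_ereal ereal.
(* Not imported: the notations of mpoly clash with those of MathComp-Analysis. *)
From mathcomp Require mpoly.

Set Implicit Arguments.
Unset Strict Implicit.
Unset Printing Implicit Defensive.

Import GRing.Theory Num.Theory.
Local Open Scope classical_set_scope.
Local Open Scope ring_scope.

Section ZariskiGeometry.
Variables (F : fieldType) (n m : nat).
Implicit Types (X Y Z : set 'M[F]_(n, m)).

(* The variable of index [mxvec_index i j] stands for the entry (i, j). *)
Definition eval_entries (p : mpoly.mpoly (n * m) F) (A : 'M[F]_(n, m)) : F :=
  mpoly.meval (fun k => mxvec A ord0 k) p.

Definition zariski_closed X : Prop :=
  exists S : set (mpoly.mpoly (n * m) F),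
    X = [set A | forall p, S p -> eval_entries p A = 0].

Definition irreducible_closed Z : Prop :=
  [/\ zariski_closed Z, Z !=set0 &
      forall Y1 Y2, zariski_closed Y1 -> zariski_closed Y2 ->
        Z = Y1 `|` Y2 -> Z = Y1 \/ Z = Y2].

Definition irreducible_component X Z : Prop :=
  [/\ irreducible_closed Z, Z `<=` X &
      forall Y, irreducible_closed Y -> Y `<=` X -> Z `<=` Y -> Y = Z].

(* W 0 < W 1 < ... < W d: a chain of length d has d + 1 members; the values
   of W beyond d are irrelevant. *)
Definition irreducible_chain X (d : nat) (W : nat -> set 'M[F]_(n, m)) : Prop :=
  [/\ forall i, (i <= d)%N -> irreducible_closed (W i),
      forall i, (i < d)%N -> W i `<` W i.+1 &
      W d `<=` X].

End ZariskiGeometry.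

Section Dimension.
Variables (R : realType) (n m : nat).
Implicit Types (X Z : set 'M[R[i]]_(n, m)).

(* Krull dimension, as an extended real so that the supremum and the infimum
   below are genuine ones; the dimension of the empty set is -oo and its
   codimension +oo. *)
Definition zariski_dim X : \bar R :=
  ereal_sup [set (d%:R)%:E | d in
    [set d : nat | exists W, irreducible_chain X d W]].

Definition zariski_codim X : \bar R :=
  ereal_inf [set (((n * m)%N%:R)%:E - zariski_dim Z)%E | Z in
    [set Z | irreducible_component X Z]].

End Dimension.

Section Columns.
Variables (F : fieldType) (n m : nat).

Definition colspace (A : 'M[F]_(n, m)) : {vspace 'cV[F]_n} :=
  <<[seq col j A | j <- enum 'I_m]>>%VS.

Definition column_invariant (X : set 'M[F]_(n, m)) : Prop :=
  forall A B : 'M[F]_(n, m), X A -> colspace A = colspace B -> X B.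

Definition col_subspaces (X : set 'M[F]_(n, m)) : set {vspace 'cV[F]_n} :=
  [set E | exists2 A, X A & (E <= colspace A)%VS].

End Columns.

(* Main.v *)
Require Import Defs.
From mathcomp Require Import all_boot all_order all_algebra.
From mathcomp Require Import complex.
From mathcomp Require Import classical_sets reals constructive_ereal ereal.
From mathcomp Require mpoly.
From mathcomp Require Import perm zify ring.
Import -(notations) mpoly.
From mathcomp Require Import boolp.

(** Why the theorem is true. Let [e] be the dimension of [E], [1 <= e <= m] being
    the essential case. The set [X] is closed and stable under right
    multiplication by invertible matrices, hence by all matrices
    ([column_invariant_mulmx]); in particular it is a cone. After a change of
    basis of the column vectors, [E] is spanned by the first [e] basis vectors.
    The banded Toeplitz matrices whose rows are the successive shifts of one row
    [(p_0, ..., p_(m-e), 0, ..., 0)], for the first [e] rows, with zero rows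
    below, form a linear space of dimension [m + 1 - e] in which every nonzero
    matrix has column space [E]. So this space meets the cone [X] only in [0],
    and [X] should have codimension at least [m + 1 - e].

    The coordinate functions on [X] are split into [cut] coordinates, the
    [n * m - (m + 1 - e)] linear forms that define the Toeplitz space, and the
    [m + 1 - e] generators [p_i]. Every polynomial function on [X] is a polynomial in
    these of controlled degree, and the key claim is that each [p_i] is nilpotent
    modulo the ideal of the cut coordinates ([coord_nilpotent]). The
    Nullstellensatz would give it from the trivial intersection, but there is a
    direct argument ([generator_nilpotent_step]). Some matrix [v] with column
    space [E] is not in [X], so a homogeneous polynomial [f] of degree [D]
    vanishes on [X] and not at [v] ([homogeneous_separation]). Modulo the cut
    coordinates and [p_0, ..., p_(i-1)], the columns [i, ..., i + e - 1] of [A]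
    form a triangular block with diagonal [p_i], and multiplying [A] on the right
    by the adjugate of this block gives [p_i^e v]. This product is in [X], so
    [0 = p_i^(e D) f(v)] modulo that ideal; an induction on [i] concludes.

    Nilpotency lets every monomial be rewritten with bounded exponents of the
    [p_i] ([pow_ideal_reduced]). Comparing numbers of monomials, any
    [n * m - (m + 1 - e) + 1] polynomials are algebraically dependent on [X]
    ([algebraic_dependence]). On the other hand a chain of [d + 1] irreducible
    closed sets carries [d] polynomials that are algebraically free on the
    largest one ([chain_algebraically_free]). Hence every chain in [X] has
    length at most [n * m - (m + 1 - e)].

    In the lemmas, [e] appears as the rank [rk] of a matrix whose columns form a
    basis of [E], so that Gaussian elimination supplies the change of basis. *)

Set Implicit Arguments.
Unset Strict Implicit.
Unset Printing Implicit Defensive.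

Import GRing.Theory.
Local Open Scope ring_scope.

(** * Linear combinations of functions *)

Section LinearCombinations.
Variables (T : Type) (F : fieldType).
Implicit Types (f g : T -> F) (G H K : (T -> F) -> Prop).

(** The span of [G], closed under pointwise equality so that no function
    extensionality is needed to rewrite its members. *)
Inductive lincomb G : (T -> F) -> Prop :=
| lincomb_gen f of G f : lincomb G f
| lincomb0 : lincomb G (fun=> 0)
| lincomb_comb c f g of lincomb G f & lincomb G g :
    lincomb G (fun x => c * f x + g x)
| lincomb_ext f g of f =1 g & lincomb G f : lincomb G g.

Lemma lincombD G f g :
  lincomb G f -> lincomb G g -> lincomb G (fun x => f x + g x).
Proof.
move=> Gf Gg; apply: lincomb_ext (lincomb_comb 1 Gf Gg) => x.
by rewrite mul1r.
Qed.

Lemma lincombZ G c f : lincomb G f -> lincomb G (fun x => c * f x).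
Proof.
move=> Gf; apply: lincomb_ext (lincomb_comb c Gf (lincomb0 G)) => x.
by rewrite addr0.
Qed.

Lemma lincomb_sum G (J : Type) (r : seq J) (P : pred J) (f : J -> T -> F) :
  (forall j, P j -> lincomb G (f j)) ->
  lincomb G (fun x => \sum_(j <- r | P j) f j x).
Proof.
move=> Gf; elim: r => [|j r IHr].
  by apply: lincomb_ext (lincomb0 G) => x; rewrite big_nil.
have [Pj|/negbTE nPj] := boolP (P j).
  by apply: lincomb_ext (lincombD (Gf _ Pj) IHr) => x; rewrite big_cons Pj.
by apply: lincomb_ext IHr => x; rewrite big_cons nPj.
Qed.

Lemma lincomb_bind G H f :
  (forall g, G g -> lincomb H g) -> lincomb G f -> lincomb H f.
Proof.
move=> GH; elim=> {f} [f /GH //||c f g _ Hf _ Hg|f g fg _ Hf].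
- exact: lincomb0.
- exact: lincomb_comb.
- exact: lincomb_ext Hf.
Qed.

Lemma lincombM G H K f g :
    (forall f g, G f -> H g -> lincomb K (fun x => f x * g x)) ->
  lincomb G f -> lincomb H g -> lincomb K (fun x => f x * g x).
Proof.
move=> GHK Gf; elim: Gf g =>
  {f} [f Gf|g _|c f1 f2 _ IH1 _ IH2 g Hg|f1 f2 f12 _ IH g Hg].
- move=> g; elim=> {g} [g Hg||c g1 g2 _ K1 _ K2|g1 g2 g12 _ K1].
  + exact: GHK.
  + by apply: lincomb_ext (lincomb0 K) => x; rewrite mulr0.
  + by apply: lincomb_ext (lincomb_comb c K1 K2) => x; ring.
  + by apply: lincomb_ext K1 => x; rewrite g12.
- by apply: lincomb_ext (lincomb0 K) => x; rewrite mul0r.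
- by apply: lincomb_ext (lincomb_comb c (IH1 _ Hg) (IH2 _ Hg)) => x; ring.
- by apply: lincomb_ext (IH _ Hg) => x; rewrite f12.
Qed.

Lemma lincomb_finite G N (h : 'I_N -> T -> F) f :
    (forall g, G g -> exists i, g =1 h i) ->
  lincomb G f -> exists c : 'I_N -> F, forall x, f x = \sum_i c i * h i x.
Proof.
move=> Gh; elim=> {f} [f /Gh[i fi]||c f g _ [a fa] _ [b gb]|f g fg _ [a fa]].
- exists (fun j => (j == i)%:R) => x; rewrite (bigD1 i) //= eqxx mul1r.
  by rewrite big1 ?addr0 // => j /negbTE ->; rewrite mul0r.
- by exists (fun=> 0) => x; rewrite big1 // => i _; rewrite mul0r.
- exists (fun i => c * a i + b i) => x; rewrite fa gb mulr_sumr -big_split /=.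
  by apply: eq_bigr => i _; ring.
- by exists a => x; rewrite -fg.
Qed.

(** More functions than generators of the space they lie in: a kernel vector
    of the matrix of coefficients is a linear relation. *)
Lemma linear_relation (E : finType) N (h : 'I_N -> T -> F) (f : E -> T -> F) :
    (forall a, exists c : 'I_N -> F, forall x, f a x = \sum_i c i * h i x) ->
    (N < #|E|)%N ->
  exists2 c : E -> F, exists a, c a != 0
    & forall x, \sum_a c a * f a x = 0.
Proof.
move=> /fin_all_exists[C fC] ltNE.
pose M := \matrix_(i < #|E|, j < N) C (enum_val i) j.
have: kermx M != 0.
  rewrite kermx_eq0 /row_free; apply: contraTN ltNE => /eqP <-.
  by rewrite -leqNgt rank_leq_col.
case/matrix0Pn=> i [j kij]; exists (fun a => kermx M i (enum_rank a)).
  by exists (enum_val j); rewrite enum_valK.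
move=> x; under eq_bigr do rewrite fC mulr_sumr.
rewrite exchange_big big1 //= => k _.
under eq_bigr do rewrite mulrA; rewrite -mulr_suml.
suff -> : \sum_a kermx M i (enum_rank a) * C a k = (kermx M *m M) i k.
  by rewrite mulmx_ker mxE mul0r.
rewrite mxE (reindex (@enum_rank E)) /=; last exact/onW_bij/enum_rank_bij.
by apply: eq_bigr => a _; rewrite [M _ _]mxE enum_rankK.
Qed.

End LinearCombinations.

(** * Ideals generated by coordinate functions, with degree bounds *)

Section Words.
Variables (T : Type) (F : fieldType) (I : finType) (y : I -> T -> F).
Implicit Types (f g : T -> F) (w : seq I) (B l : pred I).

Definition wordfun w x := \prod_(i <- w) y i x.

Definition heavy_word B (a s : nat) f :=
  exists w, [/\ (size w <= s)%N, (a <= count B w)%N & f = wordfun w].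

(** The elements of degree at most [s] of the [a]-th power of the ideal
    generated by the letters in [B], the degrees being those of expressions in
    the coordinates. For [a = 0] these are all functions of degree at most
    [s]. *)
Definition pow_ideal B a s := lincomb (heavy_word B a s).

Lemma wordfun_cat w1 w2 x : wordfun (w1 ++ w2) x = wordfun w1 x * wordfun w2 x.
Proof. exact: big_cat. Qed.

Lemma perm_wordfun w1 w2 : perm_eq w1 w2 -> wordfun w1 =1 wordfun w2.
Proof. by move=> w12 x; apply: perm_big. Qed.

Lemma wordfun_nseq n i x : wordfun (nseq n i) x = y i x ^+ n.
Proof. by rewrite /wordfun big_nseq iter_mulr_1. Qed.

Lemma pow_ideal_word B a s w :
  (size w <= s)%N -> (a <= count B w)%N -> pow_ideal B a s (wordfun w).
Proof. by move=> ws wa; apply: lincomb_gen; exists w. Qed.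

Lemma pow_ideal_weak B a b s t f :
  (b <= a)%N -> (s <= t)%N -> pow_ideal B a s f -> pow_ideal B b t f.
Proof.
move=> ba st; apply: lincomb_bind => g [w [ws wa ->]].
by apply: pow_ideal_word; [apply: leq_trans st|apply: leq_trans wa].
Qed.

Lemma pow_idealM B a b s t f g :
    pow_ideal B a s f -> pow_ideal B b t g ->
  pow_ideal B (a + b) (s + t) (fun x => f x * g x).
Proof.
apply: lincombM => {}f {}g [v [vs va ->]] [w [wt wb ->]].
apply: lincomb_ext (fun x => wordfun_cat v w x) _.
by apply: pow_ideal_word; rewrite ?size_cat ?count_cat leq_add.
Qed.

Lemma pow_ideal_cst B s c : pow_ideal B 0 s (fun=> c).
Proof.
have: pow_ideal B 0 s (wordfun [::]) by apply: pow_ideal_word.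
by move/(lincombZ c); apply: lincomb_ext => x; rewrite /wordfun big_nil mulr1.
Qed.

Lemma pow_ideal_letter B i : pow_ideal B (B i) 1 (y i).
Proof.
apply: (@lincomb_ext _ _ _ (wordfun [:: i])) => [x|].
  by rewrite /wordfun big_seq1.
by apply: pow_ideal_word => //=; rewrite addn0.
Qed.

Lemma pow_ideal_prod B (J : Type) (r : seq J) (a s : J -> nat) (f : J -> T -> F) :
    (forall j, pow_ideal B (a j) (s j) (f j)) ->
  pow_ideal B (\sum_(j <- r) a j) (\sum_(j <- r) s j)
    (fun x => \prod_(j <- r) f j x).
Proof.
move=> Bf; elim: r => [|j r IHr].
  rewrite !big_nil; apply: lincomb_ext (pow_ideal_cst B 0 1) => x.
  by rewrite big_nil.
by rewrite !big_cons; apply: lincomb_ext (pow_idealM (Bf j) IHr) => x;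
  rewrite big_cons.
Qed.

Lemma pow_ideal_exp B a s f n :
  pow_ideal B a s f -> pow_ideal B (a * n) (s * n) (fun x => f x ^+ n).
Proof.
move=> Bf; elim: n => [|n IHn]; first by rewrite !muln0; apply: pow_ideal_cst.
by rewrite !mulnS; apply: lincomb_ext (pow_idealM Bf IHn) => x; rewrite exprS.
Qed.

Lemma perm_nseq_cat w i n :
  (n <= count_mem i w)%N -> exists v, perm_eq w (nseq n i ++ v).
Proof.
move=> ni; exists (nseq (count_mem i w - n) i ++ [seq j <- w | j != i]).
rewrite catA -nseqD subnKC // -(perm_filterC (pred1 i) w).
rewrite perm_cat2r -size_filter.
by have /all_pred1P <- := filter_all (pred1 i) w.
Qed.

(** Nilpotency of [y i] modulo the ideal of [l], with cofactors whose degree is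
    less than the exponent: this bound is what a grading would provide, and
    nilpotency alone would not let the rewriting of long words terminate. *)
Definition nilpotent_letter l i :=
  exists M, pow_ideal l 1 M (fun x => y i x ^+ M).

Lemma nilpotent_letterW l i M N : (M <= N)%N ->
    pow_ideal l 1 M (fun x => y i x ^+ M) ->
  pow_ideal l 1 N (fun x => y i x ^+ N).
Proof.
move=> /subnKC <- lM; have lN := pow_ideal_exp (N - M) (pow_ideal_letter l i).
apply: (pow_ideal_weak (leq_addr _ _) (leqnn _)).
by rewrite mul1n in lN; apply: lincomb_ext (pow_idealM lM lN) => x; rewrite exprD.
Qed.

Lemma nilpotent_common l B :
    (forall i, B i -> nilpotent_letter l i) ->
  exists M, forall i, B i -> pow_ideal l 1 M (fun x => y i x ^+ M).
Proof.
move=> nilB.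
have /fin_all_exists[M lM] i : exists M, B i -> pow_ideal l 1 M (fun x => y i x ^+ M).
  by have [/nilB[M]|] := boolP (B i); [exists M|exists 0%N].
exists (\max_i M i) => i Bi; apply: nilpotent_letterW (lM i Bi).
exact: leq_bigmax.
Qed.

Lemma count_sum_mem B w : count B w = \sum_(i | B i) count_mem i w.
Proof.
elim: w => [|j w IHw] /=; first by rewrite big1.
rewrite big_split /= -IHw; congr addn; rewrite -big_mkcondr /=.
rewrite (eq_bigl (fun i => (i == j) && B i)); last by move=> i /=; rewrite eq_sym andbC.
by rewrite big_mkcondr big_pred1_eq.
Qed.

(** A word with many letters in [B] contains some letter of [B] many times, by
    the pigeonhole principle, so a large power of a sum of nilpotent terms is
    controlled without the binomial formula. *)
Lemma nilpotent_letter_step l B i K :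
    (forall j, B j -> nilpotent_letter l j) ->
  pow_ideal B 1 K (fun x => y i x ^+ K) -> nilpotent_letter l i.
Proof.
move=> /nilpotent_common[M lM] BK; set n := (#|I| * M).+1.
exists (K * n)%N; apply: (@lincomb_ext _ _ _ (fun x => (y i x ^+ K) ^+ n)).
  by move=> x; rewrite exprM.
apply: lincomb_bind (pow_ideal_exp n BK) => _ [w [ws wn ->]].
have /existsP[j /andP[Bj Mj]] : [exists j, B j && (M <= count_mem j w)%N].
  apply: contraTT wn => /existsPn ltM; rewrite -ltnNge mul1n ltnS count_sum_mem.
  rewrite -sum_nat_const big_mkcond leq_sum // => j _; case: ifP => // Bj.
  by have := ltM j; rewrite Bj -ltnNge => /ltnW.
have [v wv] := perm_nseq_cat Mj.
have vs : (size v <= size v)%N by [].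
have lw := pow_idealM (lM j Bj) (pow_ideal_word vs (leq0n (count l v))).
apply: lincomb_ext (pow_ideal_weak _ _ lw) => [x||].
- by rewrite (perm_wordfun wv) wordfun_cat wordfun_nseq.
- by rewrite addn0.
- by apply: leq_trans ws; rewrite (perm_size wv) size_cat size_nseq.
Qed.

(** Reduced words span the functions as a finite module over the algebra of the
    letters of [l]. *)
Definition reduced_word l (M s : nat) f :=
  exists w, [/\ (size w <= s)%N, forall i, ~~ l i -> (count_mem i w < M)%N
    & f = wordfun w].

(** Each replacement of a factor [y i ^ M] increases the number of letters in
    [l] and not the length, which bounds that number: the rewriting ends. *)
Lemma pow_ideal_reduced l M s f :
    (forall i, ~~ l i -> pow_ideal l 1 M (fun x => y i x ^+ M)) ->
  pow_ideal l 0 s f -> lincomb (reduced_word l M s) f.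
Proof.
move=> lM; apply: lincomb_bind => _ [w [ws _ ->]].
have [k] := ubnP (s - count l w); elim: k => // k IHk in w ws *.
rewrite ltnS => wk.
have [/forallP red|] := boolP [forall i, ~~ l i ==> (count_mem i w < M)%N].
  by apply: lincomb_gen; exists w; split=> // i; apply/implyP.
case/forallPn=> i; rewrite negb_imply -leqNgt => /andP[nli Mi].
have [v wv] := perm_nseq_cat Mi.
have wE x : y i x ^+ M * wordfun v x = wordfun w x.
  by rewrite (perm_wordfun wv) wordfun_cat wordfun_nseq.
apply: (lincomb_ext wE); apply: (lincombM _ (lM i nli)); last first.
  by apply: (@lincomb_gen _ _ (eq (wordfun v))).
move=> _ _ [u [us ul ->]] <-; apply: (lincomb_ext (wordfun_cat u v)).
have sw : (M + size v)%N = size w by rewrite (perm_size wv) size_cat size_nseq.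
have cw : count l w = count l v.
  by rewrite (seq.permP wv) count_cat count_nseq (negbTE nli).
have uvs : (size (u ++ v) <= s)%N.
  by rewrite size_cat; apply: leq_trans ws; rewrite -sw leq_add2r.
apply: IHk => //; have := count_size l (u ++ v); rewrite count_cat.
by move: wk ul uvs; rewrite cw; lia.
Qed.

Lemma wordfun_exp w x : wordfun w x = \prod_i y i x ^+ count_mem i w.
Proof.
elim: w => [|j w IHw] /=; first by rewrite /wordfun big_nil big1.
rewrite /wordfun big_cons -[X in _ * X]/(wordfun w x) IHw.
under [RHS]eq_bigr do rewrite exprD; rewrite big_split /=; congr (_ * _).
by rewrite (bigD1 j) //= eqxx expr1 big1 ?mulr1 // => i /negbTE; rewrite eq_sym => ->.
Qed.

(** A reduced word is determined, up to order, by exponents at most [s] for the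
    letters in [l] and less than [M] for the others; only the exponent [#|l|]
    of [s.+1] matters below. *)
Lemma reduced_word_box l M s : exists N (h : 'I_N -> T -> F),
  (N <= s.+1 ^ #|l| * M.+1 ^ #|I|)%N /\
  forall f, reduced_word l M s f -> exists i, f =1 h i.
Proof.
pose bd i := if l i then s.+1 else M.
pose box := family (fun i => [pred k : 'I_(s + M).+1 | (k < bd i)%N]).
exists #|box|.
exists (fun j x => \prod_i y i x ^+ (enum_val j : {ffun I -> 'I_(s + M).+1}) i).
split=> [|_ [w [ws wM ->]]].
  rewrite card_family foldrE big_map big_enum /=.
  apply: (@leq_trans (\prod_i ((if l i then s.+1 else 1) * M.+1)%N)); last first.
    by rewrite big_split /= -big_mkcond !prod_nat_const.
  apply: leq_prod => i _; have bdi : (bd i <= (s + M).+1)%N.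
    by rewrite /bd; case: ifP => _; lia.
  rewrite -sum1_card (big_ord_narrow bdi) sum1_card card_ord /bd.
  by case: ifP => _; nia.
pose e := [ffun i => inord (count_mem i w) : 'I_(s + M).+1].
have cw i : (count_mem i w < bd i)%N.
  rewrite /bd; have [_|/wM //] := boolP (l i).
  by rewrite ltnS (leq_trans (count_size _ _)).
have eE i : e i = count_mem i w :> nat.
  rewrite ffunE inordK // ltnS (leq_trans (count_size _ _)) //.
  by rewrite (leq_trans ws) ?leq_addr.
have eb : e \in box by apply/familyP => i; rewrite inE eE.
exists (enum_rank_in eb e) => x; rewrite enum_rankK_in // wordfun_exp.
by apply: eq_bigr => i _; rewrite eE.
Qed.

End Words.

(** * Algebraic dependence by counting monomials *)

Section Exponents.
Variable s : nat.

(** Exponent vectors [(a_0, ..., a_(k-1))] with entries at most [s], as iterated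
    pairs so that splitting off the last exponent is a projection. *)
Fixpoint expo (k : nat) : finType :=
  if k is k'.+1 then (expo k' * 'I_s.+1)%type else unit.

Fixpoint expo_monom (A : nzRingType) (g : nat -> A) k : expo k -> A :=
  if k is k'.+1 then fun a => expo_monom g a.1 * g k' ^+ a.2 else fun=> 1.

Lemma card_expo k : #|expo k| = (s.+1 ^ k)%N.
Proof.
by elim: k => [|k IHk]; rewrite ?card_unit // card_prod IHk card_ord expnSr.
Qed.

Lemma expo_sum (A : nzRingType) k (f : expo k.+1 -> A) :
  \sum_b f b = \sum_(a : expo k) \sum_(i < s.+1) f (a, i).
Proof. by rewrite pair_bigA; apply: eq_bigr => -[]. Qed.

Lemma eq_expo_monom (A : nzRingType) (g g' : nat -> A) k (a : expo k) :
  (forall i, (i < k)%N -> g i = g' i) -> expo_monom g a = expo_monom g' a.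
Proof.
elim: k a => //= k IHk a gg'; rewrite gg' // (IHk a.1) // => i ik.
exact/gg'/ltnW.
Qed.

Lemma rmorph_expo_monom (A B : nzRingType) (phi : {rmorphism A -> B})
    (g : nat -> A) k (a : expo k) :
  phi (expo_monom g a) = expo_monom (phi \o g) a.
Proof.
by elim: k a => [|k IHk] a /=; rewrite ?rmorph1 // rmorphM rmorphXn IHk.
Qed.

End Exponents.

Section Dependence.
Variables (T : Type) (F : fieldType) (I : finType) (y : I -> T -> F).
Variables (l : pred I).

Lemma pow_ideal_expo_monom s k D (g : nat -> T -> F) (a : expo s k) :
    (forall i, (i < k)%N -> pow_ideal y l 0 D (g i)) ->
  pow_ideal y l 0 (s * D * k) (fun x => expo_monom (g ^~ x) a).
Proof.
elim: k a => [|k IHk] a gD /=; first exact: pow_ideal_cst.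
rewrite mulnS addnC -[0%N]addn0; apply: pow_idealM.
  by apply: IHk => i ik; apply/gD/ltnW.
apply: pow_ideal_weak (pow_ideal_exp a.2 (gD k (ltnSn k))) => //.
by rewrite mulnC leq_mul2r -ltnS ltn_ord orbT.
Qed.

(** Counting: the monomials of exponents at most [s] in [k] functions number
    [(s+1)^k], while the space of reduced words that contains them has
    dimension of the order of [s^#|l|]. *)
Lemma algebraic_dependence k D (g : nat -> T -> F) :
    (forall i, ~~ l i -> nilpotent_letter y l i) ->
    (forall i, (i < k)%N -> pow_ideal y l 0 D (g i)) -> (#|l| < k)%N ->
  exists s, exists2 c : expo s k -> F, exists a, c a != 0
    & forall x, \sum_a c a * expo_monom (g ^~ x) a = 0.
Proof.
move=> /nilpotent_common[M lM] gD ltlk.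
(* (s+1)^(#l+1) exceeds (s(Dk+1)+1)^#l * C once s+1 exceeds (Dk+1)^#l * C. *)
set C := (M.+1 ^ #|I|)%N; pose s := ((D * k).+1 ^ #|l| * C)%N.
have [N [h [Nle hP]]] := reduced_word_box y l M (s * D * k).
exists s; apply: (@linear_relation _ _ _ _ h).
  move=> a; apply: (lincomb_finite hP); apply: pow_ideal_reduced => //.
  exact: pow_ideal_expo_monom.
rewrite card_expo; apply: leq_ltn_trans Nle _.
apply: (@leq_trans (s.+1 ^ #|l|.+1)%N); last by rewrite leq_pexp2l.
apply: (@leq_ltn_trans ((s.+1 * (D * k).+1) ^ #|l| * C)%N).
  rewrite leq_mul2r; apply/orP; right; case: #|l| => // r.
  by rewrite leq_exp2r //; nia.
by rewrite expnMn -mulnA -/s expnS mulnC ltn_pmul2r ?expn_gt0.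
Qed.

End Dependence.

(** * Chains of irreducible sets and algebraically free families *)

Section Chains.
Variables (F : fieldType) (n m : nat).
Implicit Types (X Z : set 'M[F]_(n, m)) (p q : mpoly (n * m) F).

Lemma eval_entriesM p q A :
  eval_entries (p * q) A = eval_entries p A * eval_entries q A.
Proof. exact: mevalM. Qed.

Lemma irreducible_prime Z p q : irreducible_closed Z ->
    (forall A, Z A -> eval_entries (p * q) A = 0) ->
  (forall A, Z A -> eval_entries p A = 0) \/
  (forall A, Z A -> eval_entries q A = 0).
Proof.
move=> [[S ZS] _ irrZ] pq0.
pose V r : set 'M[F]_(n, m) := (Z `&` [set A | eval_entries r A = 0])%classic.
have closedV r : zariski_closed (V r).
  exists (S `|` [set r])%classic; rewrite /V ZS; apply/seteqP; split=> A /=.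
    by move=> [SA rA] u [/SA|->].
  by move=> SrA; split=> [u Su|]; apply: SrA; [left|right].
have ZV : Z = (V p `|` V q)%classic.
  apply/seteqP; split=> A; last by case=> -[].
  move=> ZA; have /eqP := pq0 A ZA; rewrite eval_entriesM mulf_eq0.
  by case/orP=> /eqP ?; [left|right].
by case: (irrZ _ _ (closedV p) (closedV q) ZV) => ZE; [left|right] => A;
  rewrite ZE => -[].
Qed.

Definition algebraically_free Z k (g : nat -> mpoly (n * m) F) :=
  forall s (c : expo s k -> F),
    (forall A, Z A -> \sum_a c a * expo_monom (fun i => eval_entries (g i) A) a = 0) ->
  forall a, c a = 0.

(** A polynomial [h] that vanishes on [Z1] but not on [Z2] extends the free
    family: a relation on [Z2] of lowest order in [h] may be divided by a power
    of [h], as [Z2] is irreducible, and its constant term in [h] is then a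
    relation on [Z1]. *)
Lemma algebraically_free_step Z1 Z2 k g : zariski_closed Z1 ->
    irreducible_closed Z2 -> (Z1 `<` Z2)%classic -> algebraically_free Z1 k g ->
  exists g', algebraically_free Z2 k.+1 g'.
Proof.
move=> [S Z1E] irrZ2 [Z12 nZ21] freeg.
have [h h0 [A0 Z2A0 hA0]] : exists2 h : mpoly (n * m) F,
    (forall A, Z1 A -> eval_entries h A = 0)
    & exists2 A, Z2 A & eval_entries h A != 0.
  apply: contrapT => noh; apply: nZ21 => A Z2A; rewrite Z1E => h Sh.
  apply: contrapT => /eqP hA; apply: noh; exists h; last by exists A.
  by move=> A'; rewrite Z1E; apply.
pose g' i := if (i < k)%N then g i else h; exists g' => s c c0.
have monE (a : expo s k) A : expo_monom (fun i => eval_entries (g' i) A) a =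
    eval_entries (expo_monom g a) A.
  rewrite /eval_entries (rmorph_expo_monom (meval _)).
  by apply: eq_expo_monom => i ik; rewrite /g' ik.
have g'k : g' k = h by rewrite /g' ltnn.
suff H j : forall a (i : 'I_s.+1), i = j :> nat -> c (a, i) = 0.
  by case=> a i; apply: H.
elim/ltn_ind: j => j IHj a0 i0 i0j.
(* Q is the relation divided by h^j; the terms of lower order are zero by IHj. *)
pose Q := \sum_(a : expo s k) \sum_(i < s.+1 | (j <= i)%N)
  c (a, i) *: (expo_monom g a * h ^+ (i - j)).
have evQ A : eval_entries Q A = \sum_(a : expo s k) \sum_(i < s.+1 | (j <= i)%N)
    c (a, i) * (eval_entries (expo_monom g a) A * eval_entries h A ^+ (i - j)).
  rewrite /eval_entries raddf_sum; apply: eq_bigr => a _.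
  rewrite raddf_sum; apply: eq_bigr => i _.
  by rewrite /= mevalZ mevalM rmorphXn.
have evX A : eval_entries (h ^+ j) A = eval_entries h A ^+ j.
  exact: rmorphXn.
have hQ A : Z2 A -> eval_entries (h ^+ j * Q) A = 0.
  move=> Z2A; rewrite -[RHS](c0 A Z2A) eval_entriesM evX evQ.
  rewrite expo_sum /=.
  rewrite mulr_sumr; apply: eq_bigr => a _; rewrite mulr_sumr big_mkcond /=.
  apply: eq_bigr => i _; case: leqP => [ji|ij]; last by rewrite (IHj i) ?mul0r.
  by rewrite monE g'k -[in RHS](subnKC ji) exprD; ring.
have [hj|Q0] := irreducible_prime irrZ2 hQ.
  by have := hj A0 Z2A0; rewrite evX => /eqP; rewrite expf_eq0 (negbTE hA0) andbF.
apply: (freeg s (fun a => c (a, i0))) => A Z1A.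
rewrite -[RHS](Q0 A (Z12 A Z1A)) evQ; apply: eq_bigr => a _.
rewrite (bigD1 i0) ?i0j //= subnn expr0 mulr1 -[LHS]addr0; congr (_ * _ + _).
  rewrite -monE; apply: eq_expo_monom => i ik; by rewrite /g' ik.
rewrite big1 // => i /andP[ji ii0]; rewrite h0 // expr0n subn_eq0.
have /negbTE -> : ~~ (i <= j)%N.
  by apply: contraNN ii0 => ij; rewrite -val_eqE /= i0j eqn_leq ij ji.
by rewrite !mulr0.
Qed.

(** Each strict inclusion adds one free function: this is the inequality
    between Krull dimension and transcendence degree. *)
Lemma chain_algebraically_free X d W :
  irreducible_chain X d W -> exists g, algebraically_free (W d) d g.
Proof.
case=> irrW ltW _.
have: (d <= d)%N by [].
elim: {-2}d => [|k IHk] kd.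
  exists (fun=> 0) => s c c0 []; have [_ [A WA] _] := irrW _ kd.
  have := c0 A WA; rewrite (eq_bigr (fun=> c tt)) => [|[] _]; last first.
    by rewrite mulr1.
  by rewrite sumr_const card_unit.
have [g freeg] := IHk (ltnW kd).
have [closedW _ _] := irrW _ (ltnW kd).
exact: algebraically_free_step closedW (irrW _ kd) (ltW _ kd) freeg.
Qed.

End Chains.

(** * Column-invariant closed sets *)

Section ColumnSpace.
Variables (F : fieldType) (n m : nat).

Lemma mulmx_colspace (A : 'M[F]_(n, m)) (u : 'cV_m) : A *m u \in colspace A.
Proof.
have -> : A *m u = \sum_j u j 0 *: col j A.
  apply/colP => i; rewrite mxE summxE; apply: eq_bigr => j _.
  by rewrite !mxE mulrC.
apply: memv_suml => j _; apply/memvZ/memv_span/map_f.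
by rewrite mem_enum.
Qed.

Lemma colspace_mulmx (A : 'M[F]_(n, m)) (Z : 'M_m) :
  (colspace (A *m Z) <= colspace A)%VS.
Proof.
apply/span_subvP => _ /mapP[j _ ->].
by rewrite colE -mulmxA mulmx_colspace.
Qed.

Lemma colspace_mulmx_unit (A : 'M[F]_(n, m)) (Z : 'M_m) :
  Z \in unitmx -> colspace (A *m Z) = colspace A.
Proof.
move=> uZ; apply: subv_anti; rewrite colspace_mulmx /=.
by rewrite -{1}(mulmxK uZ A) colspace_mulmx.
Qed.

End ColumnSpace.

Section ColumnInvariantSets.
Variables (F : closedFieldType) (n m : nat).
Implicit Types (X : set 'M[F]_(n, m)) (p f : mpoly (n * m) F).

Lemma eval_entries_poly p (B : 'M[{poly F}]_(n, m)) :
  exists q : {poly F}, forall t, q.[t] = eval_entries p (map_mx (horner_eval t) B).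
Proof.
exists (\sum_(e <- msupp p) mcoeff e p *: \prod_k mxvec B ord0 k ^+ e k) => t.
rewrite /eval_entries mevalE horner_sum; apply: eq_bigr => e _.
rewrite hornerZ horner_prod; congr (_ * _); apply: eq_bigr => k _.
by rewrite horner_exp -map_mxvec [in RHS]mxE.
Qed.

(** The matrices [Z + t] are invertible for all but finitely many scalars [t],
    so a closed set stable under invertible [Z] is stable under all [Z]. *)
Lemma column_invariant_mulmx X A (Z : 'M_m) :
  zariski_closed X -> column_invariant X -> X A -> X (A *m Z).
Proof.
move=> [S XS] colX XA; rewrite XS => p Sp.
have [q qE] := eval_entries_poly p (map_mx polyC (A *m Z) + 'X *: map_mx polyC A).
have {}qE t : q.[t] = eval_entries p (A *m (Z + t%:M)).
  rewrite qE; congr eval_entries; apply/matrixP => i j.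
  rewrite mulmxDr mul_mx_scalar [LHS]mxE [RHS]mxE [in LHS]mxE [X in _ + X]mxE.
  by rewrite /horner_eval !mxE !hornerE.
have /eqP : q * char_poly (- Z) = 0.
  apply/eqP/negPn/negP => /closed_nonrootP[t]; rewrite rootM negb_or.
  case/andP=> qt; rewrite /root /char_poly -/(horner_eval t _) -det_map_mx => uZ.
  case/negP: qt; rewrite /root qE; apply/eqP.
  suff : X (A *m (Z + t%:M)) by rewrite XS; apply.
  apply: colX XA _; rewrite colspace_mulmx_unit // unitmxE unitfE.
  suff -> : Z + t%:M = map_mx (horner_eval t) (char_poly_mx (- Z)) by [].
  apply/matrixP => i j; rewrite !mxE /horner_eval !hornerE.
  by rewrite opprK addrC hornerMn hornerX.
rewrite mulf_eq0 (negbTE (monic_neq0 (char_poly_monic _))) orbF => /eqP q0.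
by have := qE 0; rewrite q0 horner0 raddf0 addr0.
Qed.

Lemma eval_homogeneousZ f D t (A : 'M[F]_(n, m)) :
    {in msupp f, forall e, mdeg e = D} ->
  eval_entries f (t *: A) = t ^+ D * eval_entries f A.
Proof.
move=> homf; rewrite /eval_entries !mevalE mulr_sumr !big_seq.
apply: eq_bigr => e /homf <-; rewrite mdegE mulrCA; congr (_ * _).
rewrite -prodrXr -big_split /=; apply: eq_bigr => k _.
by rewrite linearZ mxE exprMn.
Qed.

(** A cone is cut out by the homogeneous components of its equations, as
    [p (t A)] is a polynomial in [t] that vanishes identically. *)
Lemma homogeneous_separation X v : zariski_closed X -> column_invariant X -> ~ X v ->
  exists D, exists f, [/\ {in msupp f, forall e, mdeg e = D},
    forall A, X A -> eval_entries f A = 0 & eval_entries f v != 0].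
Proof.
move=> closedX colX nXv; have [S XS] := closedX.
have [p Sp pv] : exists2 p, S p & eval_entries p v != 0.
  apply: contrapT => nop; apply: nXv; rewrite XS => p Sp.
  by apply: contrapT => /eqP pv; apply: nop; exists p.
pose k := msize p; pose f d := pihomog mdeg d p.
have homf d : {in msupp (f d), forall e, mdeg e = d}.
  exact/dhomogP/pihomogP.
have evp A : eval_entries p A = \sum_(d < k) eval_entries (f d) A.
  by rewrite {1}(pihomog_partitionE (leqnn k)) /eval_entries raddf_sum.
have /existsP[d fdv] : [exists d : 'I_k, eval_entries (f d) v != 0].
  apply: contraNT pv => /existsPn f0; rewrite evp big1 // => d _.
  by apply/eqP/negPn.
exists d, (f d); split=> // A XA.
pose q := \poly_(d < k) eval_entries (f d) A.
have /(congr1 (fun r : {poly F} => r`_d)) : q = 0; last first.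
  by rewrite coef_poly ltn_ord coef0.
apply/eqP/negPn/negP => /closed_nonrootP[t /negP[]].
have : X (t *: A) by rewrite -mul_mx_scalar; apply: column_invariant_mulmx.
rewrite XS => /(_ p Sp); rewrite evp => XtA; rewrite /root horner_poly.
rewrite -[X in _ == X]XtA; apply/eqP/eq_bigr => i _.
by rewrite (eval_homogeneousZ _ _ (homf i)) mulrC.
Qed.

End ColumnInvariantSets.

(** * Evaluation of polynomials modulo an ideal *)

Section Congruence.
Variables (T : Type) (F : fieldType) (I : finType) (y : I -> T -> F) (B : pred I).

(** Congruence modulo the ideal of [B] between functions of degree at most [s];
    the degree bounds on both sides are what makes it multiplicative. *)
Definition congruent s (f g : T -> F) :=
  [/\ pow_ideal y B 0 s f, pow_ideal y B 0 s g
    & pow_ideal y B 1 s (fun x => f x - g x)].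

Lemma congruent_ext s f f' g g' :
  f =1 f' -> g =1 g' -> congruent s f g -> congruent s f' g'.
Proof.
move=> ff' gg' [Bf Bg Bfg].
split; [exact: lincomb_ext Bf|exact: lincomb_ext Bg|].
by apply: lincomb_ext Bfg => x; rewrite ff' gg'.
Qed.

Lemma congruentM s t f g f' g' : congruent s f g -> congruent t f' g' ->
  congruent (s + t) (fun x => f x * f' x) (fun x => g x * g' x).
Proof.
move=> [Bf Bg Bfg] [Bf' Bg' Bfg']; split; try exact: (@pow_idealM _ _ _ _ _ 0 0).
apply: lincomb_ext (lincombD (pow_idealM Bfg Bf') (pow_idealM Bg Bfg')) => x.
by ring.
Qed.

Lemma congruent_intro s f g : pow_ideal y B 0 s g ->
  pow_ideal y B 1 s (fun x => f x - g x) -> congruent s f g.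
Proof.
move=> Bg Bfg; split=> //.
apply: lincomb_ext (lincombD (pow_ideal_weak (leq0n 1) (leqnn s) Bfg) Bg) => x.
by rewrite subrK.
Qed.

Lemma congruent_refl f s : pow_ideal y B 0 s f -> congruent s f f.
Proof.
move=> Bf; split=> //; apply: lincomb_ext (lincomb0 _) => x.
by rewrite subrr.
Qed.

Lemma congruent_exp s f g k : congruent s f g ->
  congruent (s * k) (fun x => f x ^+ k) (fun x => g x ^+ k).
Proof.
move=> fg; elim: k => [|k IHk].
  by rewrite muln0; apply/congruent_refl/pow_ideal_cst.
rewrite mulnS; apply: congruent_ext (congruentM fg IHk) => x;
  by rewrite exprS.
Qed.

Lemma congruent_prod (J : Type) (r : seq J) (s : J -> nat) (f g : J -> T -> F) :
    (forall j, congruent (s j) (f j) (g j)) ->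
  congruent (\sum_(j <- r) s j)
    (fun x => \prod_(j <- r) f j x) (fun x => \prod_(j <- r) g j x).
Proof.
move=> fg; elim: r => [|j r IHr].
  rewrite big_nil.
  apply: congruent_ext (congruent_refl (pow_ideal_cst y B 0 1)) => x;
  by rewrite big_nil.
rewrite big_cons; apply: congruent_ext (congruentM (fg j) IHr) => x;
  by rewrite big_cons.
Qed.

Lemma pow_ideal_eval n m (f : mpoly (n * m) F) (M : T -> 'M[F]_(n, m)) :
    (forall i j, pow_ideal y B 0 1 (fun x => M x i j)) ->
  pow_ideal y B 0 (msize f) (fun x => eval_entries f (M x)).
Proof.
move=> BM; apply: (@lincomb_ext _ _ _ (fun x => \sum_(u <- msupp f | u \in msupp f)
   mcoeff u f * (\prod_k mxvec (M x) ord0 k ^+ u k))) => [x|].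
  by rewrite /eval_entries mevalE -big_seq.
apply: lincomb_sum => u uf; apply: lincombZ.
have Bk k : pow_ideal y B 0 (u k) (fun x => mxvec (M x) ord0 k ^+ u k).
  case/mxvec_indexP: k => i j.
  have := pow_ideal_exp (u (mxvec_index i j)) (BM i j).
  by rewrite mul1n; apply: lincomb_ext => x; rewrite mxvecE.
have := pow_ideal_prod (index_enum 'I_(n * m)) Bk.
by rewrite -mdegE; apply: pow_ideal_weak => //; apply/ltnW/msize_mdeg_lt.
Qed.

Lemma eval_homogeneous_congruent n m (f : mpoly (n * m) F) D e
    (M N : T -> 'M[F]_(n, m)) :
    {in msupp f, forall u, mdeg u = D} ->
    (forall i j, congruent e (fun x => M x i j) (fun x => N x i j)) ->
  pow_ideal y B 1 (e * D) (fun x => eval_entries f (M x) - eval_entries f (N x)).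
Proof.
move=> homf MN.
have cong u : congruent (e * mdeg u)
    (fun x => \prod_k mxvec (M x) ord0 k ^+ u k)
    (fun x => \prod_k mxvec (N x) ord0 k ^+ u k).
  rewrite mdegE big_distrr /=; apply: congruent_prod => k.
  apply: congruent_exp; case/mxvec_indexP: k => i j.
  by apply: congruent_ext (MN i j) => x; rewrite mxvecE.
apply: (@lincomb_ext _ _ _ (fun x => \sum_(u <- msupp f | u \in msupp f)
   mcoeff u f * (\prod_k mxvec (M x) ord0 k ^+ u k -
                \prod_k mxvec (N x) ord0 k ^+ u k))) => [x|].
  rewrite /eval_entries !mevalE -sumrB -big_seq.
  by apply: eq_bigr => u _; rewrite mulrBr.
apply: lincomb_sum => u uf; apply: lincombZ.
by have [_ _] := cong u; rewrite homf.
Qed.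

End Congruence.

(** * Nilpotency of the Toeplitz coordinates *)

Section Determinants.
Variables (T : Type) (F : fieldType) (I : finType) (y : I -> T -> F) (B : pred I).

Lemma pow_ideal_det k (U : T -> 'M[F]_k) :
    (forall a b, pow_ideal y B 0 1 (fun x => U x a b)) ->
  pow_ideal y B 0 k (fun x => \det (U x)).
Proof.
move=> BU; apply: lincomb_sum => s _; apply: lincombZ.
have := pow_ideal_prod (index_enum 'I_k) (fun a => BU a (s a)).
by rewrite big1 // sum_nat_const card_ord muln1.
Qed.

Lemma pow_ideal_adj k (U : T -> 'M[F]_k) a b :
    (forall a b, pow_ideal y B 0 1 (fun x => U x a b)) ->
  pow_ideal y B 0 k.-1 (fun x => (\adj (U x)) a b).
Proof.
move=> BU; apply: lincomb_ext (_ : pow_ideal _ _ _ _ (fun x => cofactor (U x) b a)).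
  by move=> x; rewrite mxE.
apply: lincombZ; apply: pow_ideal_det => i j.
by apply: lincomb_ext (BU (lift b i) (lift a j)) => x; rewrite !mxE.
Qed.

End Determinants.

Section ToeplitzCoordinates.
Variables (n m rk : nat).
Local Notation r := (m.+1 - rk)%N.

(** The coordinates in [cut] vanish exactly on the Toeplitz matrices, the others
    are the [r + 1] entries of the generating row. *)
Definition cut (kc : 'I_n.+1 * 'I_m.+1) := (0 < kc.1)%N || (r < kc.2)%N.

Definition cut_below i (kc : 'I_n.+1 * 'I_m.+1) :=
  cut kc || ((kc.1 == ord0) && (kc.2 < i)%N).

Lemma card_cut : (0 < rk)%N -> (rk <= m.+1)%N ->
  (#|cut| + r.+1 = n.+1 * m.+1)%N.
Proof.
move=> rk_gt0 rk_lem; rewrite -[X in (X * _)%N]card_ord.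
rewrite -[X in (_ * X)%N]card_ord -card_prod -(cardC cut).
congr addn.
have bnd : (r.+1 <= m.+1)%N by lia.
transitivity #|[seq ((ord0, widen_ord bnd c) : 'I_n.+1 * 'I_m.+1) | c : 'I_r.+1]|.
  rewrite card_image ?card_ord // => c c' /(congr1 (fun u => val u.2)) cc'.
  exact: val_inj.
apply: eq_card => -[k c]; rewrite !inE /cut /= negb_or -!leqNgt.
apply/codomP/andP => [[c' [-> ->]]|[]].
  by split; rewrite //= -ltnS.
rewrite leqn0 => /eqP k0 cr.
have cr' : (c < r.+1)%N by [].
by exists (Ordinal cr') => //; congr pair; exact: val_inj.
Qed.

Variables (F : closedFieldType) (X : set 'M[F]_(n.+1, m.+1)) (L : 'M[F]_n.+1).
Hypotheses (rk_gt0 : (0 < rk)%N) (rk_len : (rk <= n.+1)%N) (rk_lem : (rk <= m.+1)%N).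
Hypotheses (closedX : zariski_closed X) (colX : column_invariant X).
Hypotheses (unitL : L \in unitmx) (sepX : ~ X (L *m pid_mx rk)).
Local Notation pt := {A | X A}.

(** The entries of [A] after the change of basis that turns the matrix avoided
    by [X] into [pid_mx rk]. *)
Definition frame_entry (A : pt) := invmx L *m sval A.

Definition generator c (A : pt) := frame_entry A ord0 (inord c).

(** The banded Toeplitz matrix generated by the first [r + 1] entries of the
    first row. These matrices form a space of dimension [r + 1] whose nonzero
    members have rank [rk], and so, read in the frame, meet [X] only in [0]. *)
Definition toeplitz (k c : nat) (A : pt) :=
  if [&& (k < rk)%N, (k <= c)%N & (c <= k + r)%N] then generator (c - k) A else 0.

Definition coord (kc : 'I_n.+1 * 'I_m.+1) (A : pt) :=
  frame_entry A kc.1 kc.2 - (if (0 < kc.1)%N then toeplitz kc.1 kc.2 A else 0).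

Lemma generator_coord c : generator c =1 coord (ord0, inord c).
Proof. by move=> A; rewrite /coord /= subr0. Qed.

Lemma pow_ideal_generator B c : pow_ideal coord B 0 1 (generator c).
Proof.
have Bc := pow_ideal_letter coord B (ord0, inord c).
apply: lincomb_ext (pow_ideal_weak _ _ Bc) => //.
by move=> A; rewrite /coord /= subr0.
Qed.

Lemma pow_ideal_toeplitz B k c : pow_ideal coord B 0 1 (toeplitz k c).
Proof.
case E: [&& (k < rk)%N, (k <= c)%N & (c <= k + r)%N].
  by apply: lincomb_ext (pow_ideal_generator B (c - k)) => A; rewrite /toeplitz E.
by apply: lincomb_ext (lincomb0 _) => A; rewrite /toeplitz E.
Qed.

Lemma pow_ideal_frame_entry B k c :
  pow_ideal coord B 0 1 (fun A => frame_entry A k c).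
Proof.
have Bkc := pow_ideal_weak (leq0n _) (leqnn 1) (pow_ideal_letter coord B (k, c)).
case: (posnP k) => [k0|k_gt0].
  apply: lincomb_ext Bkc => A; rewrite /coord /= k0.
  by rewrite subr0.
apply: lincomb_ext (lincombD Bkc (pow_ideal_toeplitz B k c)) => A.
by rewrite /coord /= k_gt0 subrK.
Qed.

Lemma pow_ideal_entry B i j : pow_ideal coord B 0 1 (fun A => sval A i j).
Proof.
apply: (@lincomb_ext _ _ _ (fun A => \sum_k L i k * frame_entry A k j)) => [A|].
  by rewrite -[in RHS](mulKVmx unitL (sval A)) mxE.
by apply: lincomb_sum => k _; apply/lincombZ/pow_ideal_frame_entry.
Qed.

Section Window.
Variable i : nat.
Hypothesis i_le : (i <= r)%N.

(** On Toeplitz matrices whose generating row starts with [i] zeros, this is the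
    square block formed by the columns [i, ..., i + rk - 1] of the first [rk]
    rows. It is defined to be triangular for all [A], hence the test
    [a <= b]. *)
Definition window (A : pt) : 'M[F]_rk := \matrix_(a, b)
  if (a <= b)%N && (i + b - a <= r)%N then generator (i + b - a) A else 0.

Lemma det_window A : \det (window A) = generator i A ^+ rk.
Proof.
rewrite -det_tr det_trig; last first.
  by apply/is_trig_mxP => a b ab; rewrite !mxE leqNgt ab.
rewrite (eq_bigr (fun=> generator i A)) => [|a _].
  by rewrite prodr_const card_ord.
by rewrite !mxE leqnn addnK i_le.
Qed.

Lemma pid_mx_window A (k : 'I_n.+1) (b : 'I_rk) :
  (pid_mx rk *m window A) k b =
    if [&& (k < rk)%N, (k <= b)%N & (i + b - k <= r)%N]
    then generator (i + b - k) A else 0.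
Proof.
rewrite mxE; case: ltnP => [kr|rkk] /=; last first.
  by rewrite big1 // => a _; rewrite mxE ltnNge rkk andbF mul0r.
rewrite (bigD1 (Ordinal kr)) //= big1 ?addr0 => [|a ak].
  by rewrite !mxE eqxx kr mul1r.
rewrite mxE; case: eqP => [ka|]; last by rewrite mul0r.
by case/eqP: ak; apply/val_inj.
Qed.

Lemma pow_ideal_cut_below kc :
  cut_below i kc -> pow_ideal coord (cut_below i) 1 1 (coord kc).
Proof. by move=> ckc; have := pow_ideal_letter coord (cut_below i) kc; rewrite ckc. Qed.

(** Modulo the cut coordinates and the generators of index less than [i], the
    columns [i, ..., i + rk - 1] of the frame entries are those of the window
    in the first [rk] rows, and zero below. *)
Lemma frame_window (k : 'I_n.+1) (b : 'I_rk) :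
  pow_ideal coord (cut_below i) 1 1
    (fun A => frame_entry A k (inord (i + b)) - (pid_mx rk *m window A) k b).
Proof.
have ltb := ltn_ord b.
pose c : 'I_m.+1 := inord (i + b).
have cE : c = (i + b)%N :> nat by rewrite inordK //; lia.
have [k0|k_gt0] := posnP k.
  have k0' : k = ord0 by apply: val_inj.
  have [ibr|ribr] := leqP (i + b) r.
    apply: lincomb_ext (lincomb0 _) => A.
    by rewrite pid_mx_window k0 subn0 rk_gt0 ibr /= k0' subrr.
  have cutc : cut_below i (k, c) by rewrite /cut_below /cut /= cE ribr orbT.
  apply: lincomb_ext (pow_ideal_cut_below cutc) => A.
  by rewrite pid_mx_window /coord /= k0 subn0 [(_ <= r)%N]leqNgt ribr !andbF.
have cutc : cut_below i (k, c) by rewrite /cut_below /cut /= k_gt0.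
have cutcE := pow_ideal_cut_below cutc.
have [/and3P[krk kib ibkr]|ntoep] :=
    boolP [&& (k < rk)%N, (k <= i + b)%N & (i + b <= k + r)%N]; last first.
  apply: lincomb_ext cutcE => A; rewrite pid_mx_window /coord /= k_gt0 /toeplitz.
  rewrite cE (negbTE ntoep) ifF //; apply: contraNF ntoep.
  by case/and3P=> -> ? ?; apply/andP; split; lia.
have toepE A : toeplitz k c A = generator (i + b - k) A.
  by rewrite /toeplitz cE krk kib ibkr.
have [kb|bk] := leqP k b.
  apply: lincomb_ext cutcE => A; rewrite pid_mx_window /coord /= k_gt0 toepE.
  by rewrite krk kb ifT //; lia.
have ltm : (i + b - k < m.+1)%N by lia.
have cutg : cut_below i (ord0, inord (i + b - k)).
  by rewrite /cut_below /= inordK // orbC; apply/orP; left; lia.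
apply: lincomb_ext (lincombD cutcE (pow_ideal_cut_below cutg)) => A.
rewrite pid_mx_window /coord /= k_gt0 toepE [(k <= b)%N]leqNgt bk andbF !subr0.
by rewrite subrK.
Qed.

(** For [A] in [X] the matrix [A *m Z A] below is in [X], as [X] is stable under
    right multiplication. Since [window A *m \adj (window A)] is the scalar
    matrix [generator i A ^+ rk], it is congruent to [generator i A ^+ rk *: v]
    with [v] outside [X]. A form [f] of degree [D] that vanishes on [X] and not
    at [v] then gives [generator i ^+ (rk * D) * f v = 0] modulo the ideal. *)
Lemma generator_nilpotent_step :
    (forall kc, cut_below i kc -> nilpotent_letter coord cut kc) ->
  nilpotent_letter coord cut (ord0, inord i).
Proof.
move=> nilc; have [D [f [homf fX fv]]] := homogeneous_separation closedX colX sepX.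
apply: (nilpotent_letter_step (K := (rk * D)%N) nilc).
pose v := L *m pid_mx rk : 'M[F]_(n.+1, m.+1).
(* Right multiplication by sel selects the columns i, ..., i + rk - 1. *)
pose sel : 'M[F]_(m.+1, rk) := \matrix_(j, b) (j == inord (i + b))%:R.
pose Z A : 'M[F]_m.+1 := sel *m \adj (window A) *m pid_mx rk.
pose err A : 'M[F]_(n.+1, rk) := frame_entry A *m sel - pid_mx rk *m window A.
have errE A k b :
    err A k b = frame_entry A k (inord (i + b)) - (pid_mx rk *m window A) k b.
  rewrite [LHS]mxE [X in _ + X]mxE; congr (_ - _).
  rewrite mxE (bigD1 (inord (i + b))) //= [X in _ + X]big1 => [|j /negbTE jib].
    by rewrite [sel _ _]mxE eqxx mulr1 addr0.
  by rewrite [sel _ _]mxE jib mulr0.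
have MN A : sval A *m Z A - (generator i A ^+ rk) *: v =
    L *m (err A *m \adj (window A) *m pid_mx rk).
  rewrite -[sval A](mulKVmx unitL) -/(frame_entry A) -det_window /v /Z.
  rewrite -!mulmxA scalemxAr -mulmxBr; congr (L *m _); rewrite mulmxA /err.
  rewrite mulmxBl; congr (_ - _).
    by rewrite !mulmxA.
  rewrite -mulmxA (mulmxA (window A)) mul_mx_adj mul_scalar_mx -scalemxAr.
  by rewrite pid_mx_id.
have Bwin a b : pow_ideal coord (cut_below i) 0 1 (fun A => window A a b).
  have [gen|ngen] := boolP ((a <= b)%N && (i + b - a <= r)%N).
    apply: lincomb_ext (pow_ideal_generator (cut_below i) (i + b - a)) => A.
    by rewrite mxE gen.
  by apply: lincomb_ext (lincomb0 _) => A; rewrite mxE (negbTE ngen).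
have Bgen : pow_ideal coord (cut_below i) 0 rk (fun A => generator i A ^+ rk).
  by apply: lincomb_ext det_window _; apply: pow_ideal_det.
have cong k c : congruent coord (cut_below i) rk
    (fun A => (sval A *m Z A) k c) (fun A => ((generator i A ^+ rk) *: v) k c).
  apply: congruent_intro.
    by apply: lincomb_ext (lincombZ (v k c) Bgen) => A; rewrite [RHS]mxE mulrC.
  apply: (@lincomb_ext _ _ _ (fun A => \sum_k' L k k' * (\sum_c' pid_mx rk c' c *
    (\sum_b err A k' b * (\adj (window A)) b c')))) => [A|].
    transitivity ((sval A *m Z A - (generator i A ^+ rk) *: v) k c);
      last by rewrite [LHS]mxE [X in _ + X]mxE.
    rewrite MN [RHS]mxE; apply: eq_bigr => k' _; rewrite [in RHS]mxE.
    by congr (_ * _); apply: eq_bigr => c' _; rewrite mulrC [in RHS]mxE.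
  apply: lincomb_sum => k' _; apply: lincombZ.
  apply: lincomb_sum => c' _; apply: lincombZ.
  apply: lincomb_sum => b _.
  have Berr : pow_ideal coord (cut_below i) 1 1 (fun A => err A k' b).
    by apply: lincomb_ext (frame_window k' b) => A; rewrite errE.
  have := pow_idealM Berr (pow_ideal_adj b c' Bwin).
  by rewrite addn0 add1n prednK.
have Bf := eval_homogeneous_congruent homf cong.
apply: lincomb_ext (lincombZ (- (eval_entries f v)^-1) Bf) => A.
rewrite (fX (sval A *m Z A)); last exact: column_invariant_mulmx closedX colX (svalP A).
rewrite (eval_homogeneousZ _ _ homf) sub0r mulrNN mulrC mulfK // exprM.
by rewrite generator_coord.
Qed.

End Window.

(** The generators are treated in increasing order of index, each one modulo the
    preceding ones. *)
Lemma coord_nilpotent kc : nilpotent_letter coord cut kc.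
Proof.
have nilcut kc' : cut kc' -> nilpotent_letter coord cut kc'.
  move=> ckc; exists 1; have := pow_ideal_letter coord cut kc'.
  by rewrite ckc; apply: lincomb_ext => A; rewrite expr1.
have [/nilcut //|] := boolP (cut kc); rewrite negb_or -!leqNgt leqn0.
case: kc => k c /= /andP[/eqP k0 cr].
have -> : (k, c) = (ord0, inord c) by congr pair; apply: val_inj; rewrite //= inordK.
elim/ltn_ind: {c}(val c) cr => j IHj jr; apply: generator_nilpotent_step => //.
move=> [k' c'] /orP[/nilcut //|/andP[/= /eqP -> c'j]].
by rewrite -[c']inord_val; apply: IHj => //; apply: leq_trans (ltnW c'j) jr.
Qed.

End ToeplitzCoordinates.

(** * Dimension and codimension *)

(** The chain carries [d] algebraically free functions, while any more than
    [#|l|] functions on [X] are dependent. *)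
Lemma chain_length_le (F : fieldType) n m (X : set 'M[F]_(n, m))
    (I : finType) (y : I -> {A | X A} -> F) (l : pred I) d W :
    (forall i, ~~ l i -> nilpotent_letter y l i) ->
    (forall f : mpoly (n * m) F,
      pow_ideal y l 0 (msize f) (fun A => eval_entries f (sval A))) ->
  irreducible_chain X d W -> (d <= #|l|)%N.
Proof.
move=> nil_y eval_y chainW; have [g freeg] := chain_algebraically_free chainW.
rewrite leqNgt; apply/negP => ltld.
pose D := \max_(i < d) msize (g i).
have gD i : (i < d)%N -> pow_ideal y l 0 D (fun A => eval_entries (g i) (sval A)).
  move=> id; apply: pow_ideal_weak (eval_y (g i)) => //.
  exact: (leq_bigmax (Ordinal id)).
have [s [c [a ca] c0]] := algebraic_dependence nil_y gD ltld.
case/eqP: ca; apply: (freeg s c) => A WA.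
have [_ _ WX] := chainW.
exact: c0 (exist _ A (WX A WA)).
Qed.

Lemma chain_length_le_entries (F : fieldType) n m (X : set 'M[F]_(n, m)) d W :
  irreducible_chain X d W -> (d <= n * m)%N.
Proof.
move=> chainW.
pose y (kc : 'I_n * 'I_m) (A : {A | X A}) := sval A kc.1 kc.2.
have := chain_length_le (y := y) (l := predT) _ _ chainW.
rewrite cardT -cardE card_prod !card_ord; apply=> // f.
apply: pow_ideal_eval => i j.
exact: pow_ideal_weak (pow_ideal_letter y predT (i, j)).
Qed.

(** The matrix [col_ebase V *m pid_mx (\rank V)] has the column space of [V];
    it is [V] up to an invertible change of the columns. *)
Lemma sub_colspace_ebase (F : closedFieldType) n m (E : {vspace 'cV[F]_n})
    (V := \matrix_(i < n, j < \dim E) (vbasis E)`_j i 0) :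
  (\rank V <= m)%N ->
  (E <= colspace (col_ebase V *m pid_mx (\rank V) : 'M_(n, m)))%VS.
Proof.
move=> rkm; rewrite -{1}(span_basis (vbasisP E)); apply/span_subvP => x.
case/(nthP 0) => j; rewrite size_tuple => jE <-.
have -> : (vbasis E)`_j = V *m delta_mx (Ordinal jE) 0.
  by rewrite -colE; apply/colP => i; rewrite !mxE.
rewrite -{1}(mulmx_ebase V) -(pid_mx_id _ _ _ rkm) -!mulmxA mulmxA.
exact: mulmx_colspace.
Qed.

(** When the rank exceeds [m], the bound by the number of entries is enough.
    Rank [0] is excluded because a nonempty [X] contains the zero matrix. *)
Lemma chain_length_le_dim (F : closedFieldType) n m (X : set 'M[F]_(n, m))
    (E : {vspace 'cV[F]_n}) d W :
    zariski_closed X -> column_invariant X -> ~ col_subspaces X E ->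
    irreducible_chain X d W -> (d + m.+1 <= n * m + \dim E)%N.
Proof.
move=> closedX colX XE chainW.
pose V := \matrix_(i < n, j < \dim E) (vbasis E)`_j i 0.
have sepX : (\rank V <= m)%N -> ~ X (col_ebase V *m pid_mx (\rank V)).
  move=> rkm Xv; apply: XE.
  exists (col_ebase V *m pid_mx (\rank V)) => //; exact: sub_colspace_ebase.
have rk_gt0 : (0 < \rank V)%N.
  rewrite lt0n; apply/eqP => rk0; have [irrW _ WX] := chainW.
  have [_ [A WA] _] := irrW d (leqnn d).
  apply: sepX; rewrite rk0 // pid_mx_0 mulmx0 -(mulmx0 _ A).
  exact: column_invariant_mulmx closedX colX (WX A WA).
have rkE : (\rank V <= \dim E)%N by apply: rank_leq_col.
have rkn : (\rank V <= n)%N by apply: rank_leq_row.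
have [rkm|mrk] := leqP (\rank V) m; last first.
  by have := chain_length_le_entries chainW; lia.
have unitL := col_ebase_unit V; move: (sepX rkm) => {}sepX.
move: (col_ebase V) (\rank V) unitL sepX rk_gt0 rkE rkn rkm => L rk.
case: n m => [|n] [|m] in X E XE closedX colX d W chainW V L * => unitL sepX; try lia.
move=> rk_gt0 rkE rkn rkm.
have := chain_length_le (y := coord rk L) (l := cut rk) _ _ chainW.
have cardcut := card_cut n rk_gt0 rkm.
have := coord_nilpotent rk_gt0 rkn rkm closedX colX unitL sepX.
move=> nilc /(_ (fun i _ => nilc i)) dle.
suff : (d <= #|cut (n:=n) (m:=m) rk|)%N by lia.
apply: dle => f; apply: pow_ideal_eval => i j.
exact: pow_ideal_entry.
Qed.

Theorem theorem1 (R : realType) (n m : nat) (hn : (1 <= n)%N) (hm : (1 <= m)%N)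
    (X : set 'M[R[i]]_(n, m)) (X_nonempty : (X !=set0)%classic)
    (X_closed : zariski_closed X) (X_colinv : column_invariant X)
    (E : {vspace 'cV[R[i]]_n}) (E_notin : ~ col_subspaces X E) :
  ((m%:R + 1 - (\dim E)%:R)%R%:E <= zariski_codim X)%E.
Proof.
apply: le_ereal_inf_tmp => _ [Z [irrZ ZX _] <-].
have dimZ : (zariski_dim Z <= (((n * m)%N + \dim E)%:R - m.+1%:R)%:E)%E.
  apply: ge_ereal_sup => _ [d [W [irrW ltW WZ]] <-].
  have chainW : irreducible_chain X d W by split=> // A /WZ /ZX.
  have := chain_length_le_dim X_closed X_colinv E_notin chainW.
  by rewrite lee_fin Num.Theory.lerBrDr -natrD Num.Theory.ler_nat.
have -> : (m%:R + 1 - (\dim E)%:R)%:E =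
    ((n * m)%:R%:E - (((n * m)%N + \dim E)%:R - m.+1%:R)%:E :> \bar R)%E.
  by rewrite -EFinB; congr EFin; rewrite !natrD -[m.+1]addn1 natrD; ring.
exact: leeB dimZ.
Qed.
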